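(* Let $n\ge 5$. The group $G=\{g_\sigma\mid\sigma\in S_n\}$ of transformations of $K_n$ (under composition) is isomorphic to the symmetric group $S_n$.
   Context: $K_n=\{\boldsymbol\lambda=(\lambda^1,\dots,\lambda^{n-3})\in\mathbb{C}^{n-3}\mid \lambda^i\neq 0,1,\ \lambda^i\neq\lambda^j \text{ for all } i\neq j\}$. For $\boldsymbol\lambda\in K_n$ put $z^{\boldsymbol\lambda}_1=0$, $z^{\boldsymbol\lambda}_2=1$, $z^{\boldsymbol\lambda}_3=\infty$, $z^{\boldsymbol\lambda}_{i+3}=\lambda^i$ for $1\le i\le n-3$. For $\sigma\in S_n$ let $f^{\boldsymbol\lambda}_\sigma$ be the unique linear fractional transformation of $\widehat{\mathbb{C}}=\mathbb{C}\cup\{\infty\}$ with $f^{\boldsymbol\lambda}_\sigma(z^{\boldsymbol\lambda}_{\sigma^{-1}(1)})=0$, $f^{\boldsymbol\lambda}_\sigma(z^{\boldsymbol\lambda}_{\sigma^{-1}(2)})=1$, $f^{\boldsymbol\lambda}_\sigma(z^{\boldsymbol\lambda}_{\sigma^{-1}(3)})=\infty$, and define $g_\sigma:K_n\to K_n$ by $$g_\sigma(\boldsymbol\lambda)=\big(f^{\boldsymbol\lambda}_\sigma(z^{\boldsymbol\lambda}_{\sigma^{-1}(4)}),\dots,f^{\boldsymbol\lambda}_\sigma(z^{\boldsymbol\lambda}_{\sigma^{-1}(n)})\big).$$ *)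

(* Defs.v *)
From mathcomp Require Import all_boot all_order all_fingroup all_algebra.
From mathcomp Require Import boolp classical_sets reals.
From mathcomp Require Import complex ring.

Set Implicit Arguments.
Unset Strict Implicit.
Unset Printing Implicit Defensive.

Import GRing.Theory.
Local Open Scope ring_scope.

Section LinearFractional.
Variable F : fieldType.

(* F together with a point at infinity [None]; for F = C, the Riemann sphere. *)
Definition hat := option F.

Definition infty : hat := None.

Definition mobius (a b c d : F) (z : hat) : hat :=
  match z with
  | Some x => if c * x + d == 0 then infty
              else Some ((a * x + b) / (c * x + d))
  | None => if c == 0 then infty else Some (a / c)
  end.

Definition is_lft (f : hat -> hat) : Prop :=
  exists a b c d : F, a * d - b * c != 0 /\ f = mobius a b c d.

Lemma eq_of_subr (k u v x y : F) : u = v -> x - y = k * (u - v) -> x = y.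
Proof. by move=> ->; rewrite subrr mulr0 => /subr0_eq. Qed.

Lemma lft_inj f : is_lft f -> injective f.
Proof.
move=> [a [b [c [d [D ->]]]]] [x|] [y|] //=.
- case: eqP => [Ex|/eqP Ex]; case: eqP => [Ey|/eqP Ey] //.
    move=> _; congr Some; apply/eqP; rewrite -subr_eq0.
    have c0 : c != 0.
      apply: contraNneq D => c0; move: Ex; rewrite c0 mul0r add0r => ->.
      by rewrite !mulr0 subrr.
    have : c * (x - y) == 0 by apply/eqP; apply: (eq_of_subr (k := 1) (etrans Ex (esym Ey))); ring.
    by rewrite mulf_eq0 (negPf c0).
  move=> [/eqP]; rewrite eqr_div // => /eqP E; congr Some; apply/eqP.
  rewrite -subr_eq0.
  have : (a * d - b * c) * (x - y) == 0 by apply/eqP; apply: (eq_of_subr (k := 1) E); ring.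
  by rewrite mulf_eq0 (negPf D).
- case: eqP => [Ex|/eqP Ex]; case: eqP => [c0|/eqP c0] //.
    move: Ex; rewrite c0 mul0r add0r => d0.
    by move: D; rewrite c0 d0 !mulr0 subrr eqxx.
  move=> [/eqP]; rewrite eqr_div // => /eqP E.
  by move: D; rewrite (_ : _ - _ = 0) ?eqxx //; apply: (eq_of_subr (k := -1) E); ring.
- case: eqP => [c0|/eqP c0]; case: eqP => [Ex|/eqP Ex] //.
    move: Ex; rewrite c0 mul0r add0r => d0.
    by move: D; rewrite c0 d0 !mulr0 subrr eqxx.
  move=> [/eqP]; rewrite eqr_div // => /eqP E.
  by move: D; rewrite (_ : _ - _ = 0) ?eqxx //; apply: (eq_of_subr (k := 1) E); ring.
Qed.

Definition normalizes (p q r : hat) (f : hat -> hat) : Prop :=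
  [/\ is_lft f, f p = Some 0, f q = Some 1 & f r = infty].

Lemma mobius_scale k a b c d : k != 0 ->
  mobius (k * a) (k * b) (k * c) (k * d) = mobius a b c d.
Proof.
move=> k0; apply/funext => -[x|] /=.
  rewrite -!mulrA -!mulrDr mulf_eq0 (negPf k0) /=.
  by case: eqP => // /eqP E; rewrite -mulf_div divff // mul1r.
rewrite mulf_eq0 (negPf k0) /=.
by case: eqP => // /eqP E; rewrite -mulf_div divff // mul1r.
Qed.

Lemma lft_exists_unique (p q r : hat) : p != q -> p != r -> q != r ->
  exists! f, normalizes p q r f.
Proof.
have main a b c d : a * d - b * c != 0 ->
    mobius a b c d p = Some 0 -> mobius a b c d q = Some 1 ->
    mobius a b c d r = infty ->
    (forall a' b' c' d', a' * d' - b' * c' != 0 ->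
      mobius a' b' c' d' p = Some 0 -> mobius a' b' c' d' q = Some 1 ->
      mobius a' b' c' d' r = infty -> exists2 k, k != 0 &
      [/\ a' = k * a, b' = k * b, c' = k * c & d' = k * d]) ->
    exists! f, normalizes p q r f.
  move=> D Hp Hq Hr U; exists (mobius a b c d); split.
    by split=> //; exists a, b, c, d.
  move=> f [[a' [b' [c' [d' [D' ->]]]]] Hp' Hq' Hr'].
  have [k k0 [-> -> -> ->]] := U _ _ _ _ D' Hp' Hq' Hr'.
  by rewrite mobius_scale.
have someE (x y : F) : (Some x != Some y :> hat) -> x - y != 0.
  by rewrite subr_eq0.
have num0 (x y : F) : (if y == 0 then infty else Some (x / y)) = Some 0 -> x = 0.
  by case: (eqVneq y 0) => //= y0 [/eqP]; rewrite mulf_eq0 invr_eq0 (negPf y0) orbF => /eqP.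
have num1 (x y : F) : (if y == 0 then infty else Some (x / y)) = Some 1 -> x = y.
  by case: (eqVneq y 0) => //= y0 [/eqP]; rewrite -[1]divr1 eqr_div ?oner_neq0 // mulr1 mul1r => /eqP.
have den0 (x y : F) : (if y == 0 then infty else Some (x / y)) = infty -> y = 0.
  by case: (eqVneq y 0).
case: p q r main => [p|] [q|] [r|] main.
- move=> /someE pq /someE pr /someE qr; have qp : q - p != 0 by rewrite -opprB oppr_eq0.
  have rp : r - p != 0 by rewrite -opprB oppr_eq0.
  apply: (main (q - r) (- p * (q - r)) (q - p) (- r * (q - p))).
  + rewrite (_ : _ - _ = - ((q - r) * (q - p) * (r - p))); last by ring.
    by rewrite oppr_eq0 !mulf_neq0.
  + rewrite /= (_ : _ + - r * _ = (q - p) * (p - r)); last by ring.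
    rewrite mulf_eq0 (negPf qp) (negPf pr) /=.
    by rewrite (_ : _ + _ = 0) ?mul0r //; ring.
  + rewrite /= (_ : _ + - r * _ = (q - p) * (q - r)); last by ring.
    rewrite mulf_eq0 (negPf qp) (negPf qr) /=.
    rewrite (_ : _ + _ = (q - p) * (q - r)); last by ring.
    by rewrite divff // mulf_neq0.
  + by rewrite /= (_ : _ + - r * _ = 0) ?eqxx //; ring.
  move=> a b c d D /= /num0 Hp /num1 Hq /den0 Hr.
  have Eb : b = - (a * p) by apply: (eq_of_subr (k := 1) Hp); ring.
  have Ed : d = - (c * r) by apply: (eq_of_subr (k := 1) Hr); ring.
  have Ea : a = c * (q - r) / (q - p).
    apply: (canRL (mulfK qp)); rewrite Eb Ed in Hq; apply: (eq_of_subr (k := 1) Hq); ring.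
  have c0 : c != 0.
    by apply: contraNneq D => c0; rewrite Ed c0 mul0r oppr0 !mulr0 subrr.
  exists (c / (q - p)); first by rewrite mulf_neq0 // invr_eq0.
  by split; rewrite ?Ed ?Eb ?Ea; field.
- move=> /someE pq _ _; have qp : q - p != 0 by rewrite -opprB oppr_eq0.
  apply: (main 1 (- p) 0 (q - p)).
  + by rewrite mul1r mulr0 subr0.
  + by rewrite /= mul0r add0r (negPf qp) mul1r subrr mul0r.
  + by rewrite /= mul0r add0r (negPf qp) mul1r divff.
  + by rewrite /= eqxx.
  move=> a b c d D /= /num0 Hp /num1 Hq /den0 c0.
  have Eb : b = - (a * p) by apply: (eq_of_subr (k := 1) Hp); ring.
  have Ed : d = a * (q - p) by rewrite c0 Eb in Hq; apply: (eq_of_subr (k := -1) Hq); ring.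
  exists a.
    by apply: contraNneq D => a0; rewrite a0 c0 mul0r mulr0 subrr.
  by split; rewrite ?c0 ?Ed ?Eb; ring.
- move=> _ /someE pr _; have rp : r - p != 0 by rewrite -opprB oppr_eq0.
  apply: (main 1 (- p) 1 (- r)).
  + rewrite (_ : _ - _ = - (r - p)) ?oppr_eq0 //; ring.
  + by rewrite /= !mul1r (negPf pr) subrr mul0r.
  + by rewrite /= oner_eq0 divr1.
  + by rewrite /= mul1r subrr eqxx.
  move=> a b c d D /= /num0 Hp /num1 Hq /den0 Hr.
  have Eb : b = - (a * p) by apply: (eq_of_subr (k := 1) Hp); ring.
  have Ed : d = - (c * r) by apply: (eq_of_subr (k := 1) Hr); ring.
  exists c.
    by apply: contraNneq D => c0; rewrite Ed c0 mul0r oppr0 !mulr0 subrr.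
  by split; rewrite ?Ed ?Eb ?Hq; ring.
- by move=> _ _ /eqP.
- move=> _ _ /someE qr.
  apply: (main 0 (q - r) 1 (- r)).
  + by rewrite mul0r mulr1 sub0r oppr_eq0.
  + by rewrite /= oner_eq0 mul0r.
  + by rewrite /= mul0r mul1r add0r (negPf qr) divff.
  + by rewrite /= mul1r subrr eqxx.
  move=> a b c d D /= /num0 a0 /num1 Hq /den0 Hr.
  have Ed : d = - (c * r) by apply: (eq_of_subr (k := 1) Hr); ring.
  have Eb : b = c * (q - r) by rewrite a0 Ed in Hq; apply: (eq_of_subr (k := 1) Hq); ring.
  exists c.
    by apply: contraNneq D => c0; rewrite Ed c0 a0 mul0r mulr0 subrr.
  by split; rewrite ?a0 ?Ed ?Eb; ring.
- by move=> _ /eqP.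
- by move=> /eqP.
- by move=> /eqP.
Qed.

End LinearFractional.

Arguments infty {F}.

Section ConfigurationSpace.
Variables (F : fieldType) (n : nat).

Definition inK (l : (n - 3).-tuple F) : bool :=
  [forall i, (tnth l i != 0) && (tnth l i != 1)] &&
  [forall i, forall j, (i != j) ==> (tnth l i != tnth l j)].

Definition K : Type := {l : (n - 3).-tuple F | inK l}.

(* Indices are shifted by one with respect to the usual 1, ..., n: the points
   numbered 0, 1, 2 are 0, 1, infinity, and point i + 3 is the i-th coordinate
   of l.  For 3 <= n the listed sequence has exactly n elements. *)
Definition z (l : K) (k : 'I_n) : hat F :=
  nth infty [:: Some 0, Some 1, infty & [seq Some x | x <- val l]] k.

Hypothesis hn : (5 <= n)%N.

Fact n_gt0 : (0 < n)%N. Proof. exact: leq_trans hn. Qed.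
Fact n_gt1 : (1 < n)%N. Proof. exact: leq_trans hn. Qed.
Fact n_gt2 : (2 < n)%N. Proof. exact: leq_trans hn. Qed.
Fact shift3_subproof (i : 'I_(n - 3)) : (i + 3 < n)%N.
Proof. by rewrite addnC -ltn_subRL. Qed.

Definition pt0 : 'I_n := Ordinal n_gt0.
Definition pt1 : 'I_n := Ordinal n_gt1.
Definition pt2 : 'I_n := Ordinal n_gt2.
Definition shift3 (i : 'I_(n - 3)) : 'I_n := Ordinal (shift3_subproof i).

Lemma z_inj (l : K) : injective (z l).
Proof.
case: l => l; rewrite /z /= => /andP[/forallP l01 /forallP li'].
have li i j := forallP (li' i) j.
set s := (X in nth _ X).
have sz : size s = n by rewrite /= size_map size_tuple -[RHS](subnKC n_gt2).
have ul : uniq l.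
  apply/(uniqP 0) => i j; rewrite !inE size_tuple => ilt jlt.
  move: (li (Ordinal ilt) (Ordinal jlt)); rewrite !(tnth_nth 0) /=.
  move=> /implyP H E; apply/eqP; apply: contraT => ij.
  by have := H ij; rewrite E eqxx.
have us : uniq s.
  have sinj : injective (@Some F) by move=> ? ? [].
  rewrite /= !inE /= !mem_map // map_inj_uniq // ul.
  have -> : (0 \in val l) = false.
    apply/negbTE/tnthP => -[i E].
    by have /andP[] := l01 i; rewrite -E eqxx.
  have -> : (1 \in val l) = false.
    apply/negbTE/tnthP => -[i E].
    by have /andP[] := l01 i; rewrite -E eqxx.
  rewrite !orbF /= andbT.
  apply/andP; split.
    by apply/eqP => -[/esym/eqP]; rewrite oner_eq0.
  by apply/mapP => -[].
move=> i j /eqP; rewrite nth_uniq ?sz ?ltn_ord // => /eqP; exact: val_inj.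
Qed.

Lemma f_exists_unique (s : 'S_n) (l : K) :
  exists! f, normalizes (z l ((s^-1)%g pt0)) (z l ((s^-1)%g pt1))
                        (z l ((s^-1)%g pt2)) f.
Proof.
by apply: lft_exists_unique; rewrite (inj_eq (@z_inj l)) (inj_eq perm_inj).
Qed.

Definition f_ (s : 'S_n) (l : K) : hat F -> hat F :=
  projT1 (cid (f_exists_unique s l)).

Lemma f_normalizes (s : 'S_n) (l : K) :
  normalizes (z l ((s^-1)%g pt0)) (z l ((s^-1)%g pt1))
             (z l ((s^-1)%g pt2)) (f_ s l).
Proof. by rewrite /f_; case: cid => f []. Qed.

(* The default value 0 is never used: see [g_tupleE]. *)
Definition g_tuple (s : 'S_n) (l : K) : (n - 3).-tuple F :=
  [tuple odflt 0 (f_ s l (z l ((s^-1)%g (shift3 i)))) | i < n - 3].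

Lemma g_tupleE (s : 'S_n) (l : K) (i : 'I_(n - 3)) :
  f_ s l (z l ((s^-1)%g (shift3 i))) = Some (tnth (g_tuple s l) i).
Proof.
rewrite tnth_mktuple; case E: (f_ _ _ _) => [//|].
have [L _ _ H] := f_normalizes s l.
move: (etrans E (esym H)) => /(lft_inj L)/z_inj/perm_inj/(congr1 val) /=.
by rewrite addn3.
Qed.

Lemma inK_g_tuple (s : 'S_n) (l : K) : inK (g_tuple s l).
Proof.
have [L H0 H1 _] := f_normalizes s l.
apply/andP; split; apply/forallP => i.
  apply/andP; split; apply/eqP => E; have := g_tupleE s l i; rewrite E.
    rewrite -H0 => /(lft_inj L)/z_inj/perm_inj/(congr1 val) /=.
    by rewrite addn3.
  rewrite -H1 => /(lft_inj L)/z_inj/perm_inj/(congr1 val) /=.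
  by rewrite addn3.
apply/forallP => j; apply/implyP; apply: contraNneq => E.
have := g_tupleE s l i; rewrite E -g_tupleE.
move=> /(lft_inj L)/z_inj/perm_inj/(congr1 val) /= /eqP.
by rewrite eqn_add2r.
Qed.

Definition g (s : 'S_n) (l : K) : K := exist _ (g_tuple s l) (inK_g_tuple s l).

Definition G : set (K -> K) := [set h | exists s : 'S_n, h = g s].

End ConfigurationSpace.

Arguments G F {n} hn.

Definition transformation_group (X : Type) (H : set (X -> X)) : Prop :=
  [/\ H id,
      forall f h, H f -> H h -> H (f \o h)
    & forall f, H f -> exists2 h, H h & cancel f h /\ cancel h f].

(* Meaningful when H is a transformation group.  The product on 'S_n is
   composition in diagrammatic order, (s * t) x = t (s x), which is the opposite
   of the order of [\o]; a group being isomorphic to its opposite through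
   inversion, this does not affect the existence of phi. *)
Definition transformation_group_isog (X : Type) (H : set (X -> X))
    (gT : groupType) : Prop :=
  exists phi : gT -> X -> X,
    [/\ injective phi, range phi = H
      & forall s t : gT, phi (s * t)%g = phi s \o phi t].

(* Main.v *)
Require Import Defs.
From mathcomp Require Import all_boot all_fingroup all_algebra.
From mathcomp Require Import boolp classical_sets.
From mathcomp Require Import reals complex ring.

Set Implicit Arguments.
Unset Strict Implicit.
Unset Printing Implicit Defensive.

Import GRing.Theory Num.Theory.
Local Open Scope ring_scope.

(** Call two configurations of n distinct points of the projective line
    equivalent when a linear fractional map carries one to the other, point by
    point.  Every configuration w is equivalent to z l for exactly one l in K,
    because a linear fractional map is determined by the inverse images of
    0, 1 and infinity; thus K is the set of equivalence classes, and g s l is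
    the class of z l \o s^-1 ([z_g], [g_unique], [normal_form]).

    Since linear fractional maps compose ([lft_comp]), it follows that
    g t \o g s = g (s * t) ([g_comp]), so that s |-> g s^-1 is a homomorphism
    from the symmetric group onto G.

    Its injectivity uses 5 <= n.  If g s = id then, with t := s^-1, w \o t is
    equivalent to w for every configuration w.  Suppose t a != a.  As 5 <= n,
    there are three indices b, c, d other than a and t a.  Move the point number
    t a, and no other point.  The linear fractional map from w \o t to w
    keeps its values at the points number t b, t c, t d, hence does not change
    at all; it sends both the old and the new point number t a to the point
    number a, which did not move.  This contradicts its injectivity ([rigid]).
    *)

(** * Linear fractional maps *)

Section LinearFractional.
Variable F : fieldType.
Implicit Types (f : hat F -> hat F) (p q r : hat F).

(** The point of the projective line with homogeneous coordinates (x : y): in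
    these coordinates a linear fractional map is linear, so that infinity needs
    no separate treatment. *)
Definition ratio (x y : F) : hat F := if y == 0 then infty else Some (x / y).

Lemma ratioP p : exists x y, (x != 0) || (y != 0) /\ p = ratio x y.
Proof.
case: p => [x|].
  by exists x, 1; rewrite /ratio oner_eq0 divr1 orbT.
by exists 1, 0; rewrite /ratio oner_eq0 eqxx.
Qed.

Lemma mobius_ratio (a b c d x y : F) : (x != 0) || (y != 0) ->
  mobius a b c d (ratio x y) = ratio (a * x + b * y) (c * x + d * y).
Proof.
rewrite /ratio; case: (eqVneq y 0) => [->|y0] /=.
  rewrite orbF !mulr0 !addr0 => x0; rewrite mulf_eq0 (negPf x0) orbF.
  by case: eqP => // /eqP c0; rewrite -mulf_div divff // mulr1.
move=> _.
have E u v : u * (x / y) + v = (u * x + v * y) / y.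
  by rewrite mulrDl mulfK // mulrA.
rewrite !E mulf_eq0 invr_eq0 (negPf y0) orbF.
by case: eqP => // /eqP h; rewrite -mulf_div divff ?mulr1 ?invr_eq0.
Qed.

Lemma linear_neq0 (a b c d x y : F) : a * d - b * c != 0 ->
  (x != 0) || (y != 0) -> (a * x + b * y != 0) || (c * x + d * y != 0).
Proof.
move=> D; rewrite -!negb_and; apply: contraNN => /andP[/eqP X0 /eqP Y0].
have Ex : (a * d - b * c) * x = d * (a * x + b * y) - b * (c * x + d * y).
  by ring.
have Ey : (a * d - b * c) * y = a * (c * x + d * y) - c * (a * x + b * y).
  by ring.
move: Ex Ey; rewrite X0 Y0 !mulr0 subrr => /eqP + /eqP.
by rewrite !mulf_eq0 (negPf D) /= => -> ->.
Qed.

Lemma mobius_comp (a b c d a' b' c' d' : F) : a' * d' - b' * c' != 0 ->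
  mobius a b c d \o mobius a' b' c' d' =
  mobius (a * a' + b * c') (a * b' + b * d') (c * a' + d * c') (c * b' + d * d').
Proof.
move=> D; apply/funext => p /=.
have [x [y [xy ->]]] := ratioP p.
by rewrite !mobius_ratio ?linear_neq0 //; congr ratio; ring.
Qed.

Lemma mobius_id : mobius 1 0 0 1 = id :> (hat F -> hat F).
Proof.
by apply/funext => -[x|] /=; rewrite ?eqxx // mul0r add0r oner_eq0 mul1r addr0 divr1.
Qed.

Lemma lft_id : is_lft (id : hat F -> hat F).
Proof.
by exists 1, 0, 0, 1; rewrite mobius_id mulr1 mulr0 subr0 oner_eq0.
Qed.

Lemma lft_comp f f' : is_lft f -> is_lft f' -> is_lft (f \o f').
Proof.
move=> [a [b [c [d [D ->]]]]] [a' [b' [c' [d' [D' ->]]]]].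
rewrite mobius_comp //.
do 4 eexists; split; last reflexivity.
have -> : (a * a' + b * c') * (c * b' + d * d') -
          (a * b' + b * d') * (c * a' + d * c') =
          (a * d - b * c) * (a' * d' - b' * c') by ring.
exact: mulf_neq0.
Qed.

Lemma lft_inv f : is_lft f -> exists2 h, is_lft h & cancel f h.
Proof.
move=> [a [b [c [d [D ->]]]]]; exists (mobius d (- b) (- c) a).
  exists d, (- b), (- c), a; split=> //.
  by rewrite mulrNN mulrC.
move=> p; rewrite -[LHS]/((mobius _ _ _ _ \o mobius _ _ _ _) p) mobius_comp //.
(* a matrix times its adjugate is a scalar matrix, of scalar the determinant *)
rewrite -[RHS]/(id p) -mobius_id -(mobius_scale 1 0 0 1 D).
by congr (mobius _ _ _ _ p); ring.
Qed.

(** Follows a normalization of the common image of the three points, which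
    reduces it to the case of the values 0, 1 and infinity. *)
Lemma lft_eq3 f f' p q r : is_lft f -> is_lft f' ->
  p != q -> p != r -> q != r ->
  f p = f' p -> f q = f' q -> f r = f' r -> f = f'.
Proof.
move=> Lf Lf' pq pr qr Ep Eq Er.
have inj := inj_eq (lft_inj Lf).
have [m [[Lm m0 m1 moo] _]] : exists! m, normalizes (f p) (f q) (f r) m.
  by apply: lft_exists_unique; rewrite inj.
have [h [_ hU]] := lft_exists_unique pq pr qr.
have E1 : h = m \o f by apply: hU; split=> //; apply: lft_comp.
have E2 : h = m \o f'.
  by apply: hU; split; rewrite /= -?Ep -?Eq -?Er //; apply: lft_comp.
apply/funext => x; apply: (lft_inj Lm).
by rewrite -[LHS]/((m \o f) x) -E1 E2.
Qed.

End LinearFractional.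

(** * Configurations and their normal forms *)

Section Configurations.
Variables (F : fieldType) (n : nat).
Hypothesis hn : (5 <= n)%N.
Implicit Types (s t : 'S_n) (l : K F n) (k : 'I_n).

Variant index_spec : 'I_n -> Prop :=
  | Index0 : index_spec (pt0 hn)
  | Index1 : index_spec (pt1 hn)
  | Index2 : index_spec (pt2 hn)
  | IndexShift i : index_spec (shift3 i).

Lemma indexP k : index_spec k.
Proof.
case: k => -[|[|[|m]]] lt_m.
- by rewrite (_ : Ordinal _ = pt0 hn); [constructor | apply: val_inj].
- by rewrite (_ : Ordinal _ = pt1 hn); [constructor | apply: val_inj].
- by rewrite (_ : Ordinal _ = pt2 hn); [constructor | apply: val_inj].
have lt_m3 : (m < n - 3)%N by rewrite ltn_subRL.
rewrite (_ : Ordinal _ = shift3 (Ordinal lt_m3)); first by constructor.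
by apply: val_inj; rewrite /= addn3.
Qed.

Lemma z_shift3 l i : z l (shift3 i) = Some (tnth (val l) i).
Proof.
rewrite /z /= addn3 /= (nth_map 0) ?size_tuple ?ltn_ord //.
by rewrite (tnth_nth 0).
Qed.

Lemma z_ext l l' : z l =1 z l' -> l = l'.
Proof.
move=> E; apply: val_inj; apply: eq_from_tnth => i.
by have := E (shift3 i); rewrite !z_shift3 => -[].
Qed.

Lemma z_g s l k : z (g hn s l) k = f_ hn s l (z l ((s^-1)%g k)).
Proof.
have [_ f0 f1 foo] := f_normalizes hn s l.
case: (indexP k) => [|||i]; rewrite ?f0 ?f1 ?foo //.
by rewrite z_shift3 g_tupleE.
Qed.

(** The characterization through which all identities between the g s are
    proved: g s l is the only point of K that represents the class of
    z l \o s^-1, since an f as below is forced to be f_ s l. *)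
Lemma g_unique s l l' f : is_lft f ->
  (forall k, z l' k = f (z l ((s^-1)%g k))) -> l' = g hn s l.
Proof.
move=> Lf E; apply: z_ext => k; rewrite z_g E.
have [h [_ hU]] := f_exists_unique hn s l.
have hf : h = f by apply: hU; split; rewrite // -E.
by rewrite -(hU _ (f_normalizes hn s l)) hf.
Qed.

(** Since g s l is defined only for configurations of the form z l, this is what
    allows the choice of the most convenient configuration, such as one whose
    first three points are not 0, 1 and infinity. *)
Lemma normal_form (w : 'I_n -> hat F) : injective w ->
  exists l m, is_lft m /\ forall k, z l k = m (w k).
Proof.
move=> w_inj.
have [m [[Lm m0 m1 moo] _]] :
    exists! m, normalizes (w (pt0 hn)) (w (pt1 hn)) (w (pt2 hn)) m.
  by apply: lft_exists_unique; rewrite (inj_eq w_inj).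
have mw_inj : injective (m \o w) := inj_comp (lft_inj Lm) w_inj.
pose l := [tuple odflt 0 (m (w (shift3 i))) | i < n - 3].
have lE i : m (w (shift3 i)) = Some (tnth l i).
  rewrite tnth_mktuple; case E: (m _) => [//|].
  by move: (etrans E (esym moo)) => /mw_inj/(congr1 val) /=; rewrite addn3.
have lK : inK l.
  apply/andP; split; apply/forallP => i.
    apply/andP; split; apply/eqP => E; have := lE i; rewrite E.
      by rewrite -m0 => /mw_inj/(congr1 val) /=; rewrite addn3.
    by rewrite -m1 => /mw_inj/(congr1 val) /=; rewrite addn3.
  apply/forallP => j; apply/implyP; apply: contraNneq => E.
  have := lE i; rewrite E -lE => /mw_inj/(congr1 val) /= /eqP.
  by rewrite eqn_add2r.
exists (exist _ l lK), m; split=> // k.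
by case: (indexP k) => [|||i]; rewrite ?m0 ?m1 ?moo // z_shift3 lE.
Qed.

(** * The action of the symmetric group *)

Lemma g1 : g hn 1%g = id :> (K F n -> K F n).
Proof.
apply/funext => l; apply/esym/(g_unique (lft_id F)) => k.
by rewrite invg1 perm1.
Qed.

Lemma g_comp s t : g hn t \o g hn s = g hn (s * t)%g :> (K F n -> K F n).
Proof.
apply/funext => l /=.
have [Lt _ _ _] := f_normalizes hn t (g hn s l).
have [Ls _ _ _] := f_normalizes hn s l.
apply: (g_unique (lft_comp Lt Ls)) => k.
by rewrite !z_g invMg permM.
Qed.

Lemma gVK s : cancel (g hn s : K F n -> K F n) (g hn (s^-1)%g).
Proof. by move=> l; rewrite -[LHS]/((_ \o _) l) g_comp mulgV g1. Qed.

Lemma G_transformation_group : transformation_group (G F hn).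
Proof.
split.
- by exists 1%g; rewrite g1.
- by move=> _ _ [s ->] [t ->]; exists (t * s)%g; rewrite g_comp.
- move=> _ [s ->]; exists (g hn (s^-1)%g); first by exists (s^-1)%g.
  by split; [exact: gVK | rewrite -{2}(invgK s); exact: gVK].
Qed.

(** Two configurations w that differ in the point number t a only give the same
    f, which is thus not injective.
    The configuration e has its points at finite distance, so that infinity is
    a free place to which one of them can be moved. *)
Lemma rigid (e : 'I_n -> F) t : injective e ->
  (forall w : 'I_n -> hat F, injective w ->
     exists f, is_lft f /\ forall k, f (w (t k)) = w k) ->
  t = 1%g.
Proof.
move=> e_inj H; apply/permP => a; rewrite perm1; apply/eqP.
apply: contraT => taa.
have /card_gt2P [b [c [d [[Ab Ac Ad] [bc cd db]]]]] :
    (2 < #|~: [set a; t a]|)%N.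
  have := cardsC [set a; t a]; rewrite cards2 eq_sym taa card_ord => E.
  by rewrite -(ltn_add2l 2) E.
have w_inj : injective (Some \o e) by move=> ? ? [/e_inj].
pose w' k := if k == t a then infty else Some (e k).
have w'_inj : injective w'.
  rewrite /w' => i j; case: eqP => [->|_]; case: eqP => [->|_] //.
  by move=> [/e_inj].
have w'E k : k != t a -> w' k = Some (e k) by rewrite /w' => /negPf ->.
have [f [Lf fE]] := H _ w_inj.
have [f' [Lf' f'E]] := H _ w'_inj.
have agree k : k \in ~: [set a; t a] -> f (Some (e (t k))) = f' (Some (e (t k))).
  rewrite !inE negb_or => /andP[ka kta].
  have tka : t k != t a by rewrite (inj_eq perm_inj).
  by rewrite -[in RHS](w'E _ tka) f'E (w'E _ kta); apply: fE.
have ne i j : i != j -> Some (e (t i)) != Some (e (t j)) :> hat F.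
  by rewrite (inj_eq w_inj) (inj_eq perm_inj).
have ff' : f = f'.
  by apply: (lft_eq3 Lf Lf' _ _ _ (agree _ Ab) (agree _ Ac) (agree _ Ad));
    apply: ne; rewrite // eq_sym.
have old : f (Some (e (t a))) = Some (e a) := fE a.
have new : f infty = Some (e a).
  by rewrite -w'E 1?eq_sym // -f'E -ff' /w' eqxx.
by move: (etrans old (esym new)) => /(lft_inj Lf).
Qed.

Lemma g_eq_id (e : 'I_n -> F) s : injective e ->
  g hn s = id :> (K F n -> K F n) -> s = 1%g.
Proof.
move=> e_inj gs; apply: invg_inj; rewrite invg1; apply: (rigid e_inj) => w w_inj.
(* the map that realizes the equivalence for the normal form of w, conjugated back to w *)
have [l [m [Lm lE]]] := normal_form w_inj.
have [m' Lm' mK] := lft_inv Lm.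
have [Lf _ _ _] := f_normalizes hn s l.
exists (m' \o (f_ hn s l \o m)); split=> [|k].
  by apply: lft_comp => //; apply: lft_comp.
by rewrite /= -lE -z_g gs lE mK.
Qed.

Lemma G_isog_Sym (e : 'I_n -> F) : injective e ->
  transformation_group_isog (G F hn) 'S_n.
Proof.
(* the inversion turns the anti-homomorphism g into a homomorphism *)
move=> e_inj; exists (fun s => g hn (s^-1)%g); split.
- move=> s t /= E; apply/eqP; rewrite eq_mulgV1; apply/eqP.
  apply: (g_eq_id e_inj); rewrite -g_comp -E g_comp.
  by rewrite mulgV g1.
- apply/seteqP; split=> [_ [s _ <-]|_ [s ->]]; first by exists (s^-1)%g.
  by exists (s^-1)%g; rewrite ?invgK.
- by move=> s t; rewrite invMg g_comp.
Qed.

End Configurations.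

Theorem theorem5 (R : realType) (n : nat) (hn : (5 <= n)%N) :
  transformation_group (G R[i] hn) /\
  transformation_group_isog (G R[i] hn) 'S_n.
Proof.
split; first exact: G_transformation_group.
apply: (@G_isog_Sym _ _ hn (fun k => (k : nat)%:R)) => i j /eqP.
by rewrite eqr_nat => /eqP/val_inj.
Qed.
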